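(* Let $G$ be a finite graph with an edge coloring $c:E(G)\to\{red,blue\}$. If $G$ is connected and $(G,c)$ is not adaptably $2$-colorable, then $(G,c)$ contains an alternating bicycle (as a subgraph, with edge colors given by $c$).
   Context: Graphs are finite and simple; edge colorings need not be proper. A vertex coloring $\sigma:V\to\{red,blue\}$ is adapted to $c$ if for every edge $uv$ either $\sigma(u)\neq c(uv)$ or $\sigma(v)\ne c(uv)$; $(G,c)$ is adaptably $2$-colorable if some vertex coloring is adapted to $c$. A bicycle is a graph composed of a path $P=v_1v_2\cdots v_s$ (distinct vertices) along with two further edges $v_1v_i$ and $v_jv_s$ for some $i,j\in\{1,\dots,s\}$. A path $v_1v_2\cdots v_l$ is alternating (under $c$) if $c(v_{t-1}v_t)\ne c(v_tv_{t+1})$ for all $2\le t\le l-1$. A bicycle is alternating under $c$ if it can be decomposed into an alternating path $P=v_1v_2\cdots v_s$ and two edges $v_1v_i$ and $v_sv_j$ with $c(v_1v_i)\neq c(v_1v_2)$ and $c(v_sv_j)\neq c(v_{s-1}v_s)$. (Both $i\le j$ and $i>j$ are allowed.) *)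

(* Defs.v *)
From mathcomp Require Import all_boot.

Set Implicit Arguments.
Unset Strict Implicit.
Unset Printing Implicit Defensive.

Variant color := Red | Blue.

(* A finite simple graph is a symmetric irreflexive [e : rel T] on a finType. *)
(* The edge uv is the two-element set {u, v}; an edge coloring is a function  *)
(* [c : {set T} -> color], of which only the values on [edges e] matter.      *)
Definition edge (T : finType) (u v : T) : {set T} := [set u; v].

Definition edges (T : finType) (e : rel T) : {set {set T}} :=
  [set edge u v | u in T, v in e u].

Definition graph_connected (T : finType) (e : rel T) : Prop :=
  forall x y : T, connect e x y.

Definition adapted (T : finType) (e : rel T) (c : {set T} -> color)
    (sigma : T -> color) : Prop :=
  forall u v : T, e u v ->
    sigma u <> c (edge u v) \/ sigma v <> c (edge u v).

Definition adaptably_2_colorable (T : finType) (e : rel T)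
    (c : {set T} -> color) : Prop :=
  exists sigma : T -> color, adapted e c sigma.

(* The path v_1 ... v_s is given by [v : nat -> T] and its number [s] of      *)
(* vertices; only the values v 1, ..., v s are used.                          *)
Definition path_edges (T : finType) (v : nat -> T) (s : nat) : {set {set T}} :=
  [set edge (v t) (v t.+1) | t : 'I_s & 0 < t].

(* The graph with edge set [F] is the bicycle made of the path v_1 ... v_s    *)
(* and the edges v_1 v_i and v_s v_j. These are two further edges: they are   *)
(* distinct and not on the path. No vertex is isolated, so [F] determines the *)
(* graph; loops are excluded as soon as [F] consists of edges of a simple     *)
(* graph, and this also forces 2 <= s.                                        *)
Definition bicycle_decomposition (T : finType) (F : {set {set T}})
    (v : nat -> T) (s i j : nat) : Prop :=
  [/\ {in [pred t | 1 <= t <= s] &, injective v},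
      1 <= i <= s
    & 1 <= j <= s] /\
  [/\ edge (v 1) (v i) \notin path_edges v s,
      edge (v s) (v j) \notin path_edges v s,
      edge (v 1) (v i) != edge (v s) (v j)
    & F = path_edges v s :|: [set edge (v 1) (v i); edge (v s) (v j)]].

Definition alternating_path (T : finType) (c : {set T} -> color)
    (v : nat -> T) (l : nat) : Prop :=
  forall t : nat, 2 <= t <= l.-1 ->
    c (edge (v t.-1) (v t)) <> c (edge (v t) (v t.+1)).

Definition alternating_bicycle (T : finType) (c : {set T} -> color)
    (F : {set {set T}}) : Prop :=
  exists (v : nat -> T) (s i j : nat),
    [/\ bicycle_decomposition F v s i j,
        alternating_path c v s,
        c (edge (v 1) (v i)) <> c (edge (v 1) (v 2))
      & c (edge (v s) (v j)) <> c (edge (v s.-1) (v s))].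

(* Main.v *)
Require Import Defs.
From mathcomp Require Import all_boot.
From mathcomp Require Import zify.
From Stdlib Require Import Classical_Prop Classical_Pred_Type.

(** In a minimal set [H] of vertices on which no adapted coloring exists, every
    vertex sees both colors: otherwise it could be given the missing color. So
    both ends of a longest alternating path in [H] send an edge of the other
    color back into the path, and this is an alternating bicycle unless the two
    edges are the same, closing the path to an alternating cycle. If a vertex of
    that cycle had any further neighbor in [H], rotating and reversing the cycle
    would give a bicycle or a longer path. So the cycle is a whole component,
    which is adapted by giving each vertex the color of the edge that follows
    it; this contradicts the minimality of [H]. *)

Set Implicit Arguments.
Unset Strict Implicit.
Unset Printing Implicit Defensive.

Lemma edgeC (T : finType) (x y : T) : edge x y = edge y x.
Proof. exact: setUC. Qed.

Lemma edge_inj (T : finType) (a b d f : T) :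
  edge a b = edge d f -> (a = d /\ b = f) \/ (a = f /\ b = d).
Proof.
move=> E; have: a \in edge d f by rewrite -E set21.
have: b \in edge d f by rewrite -E set22.
have: d \in edge a b by rewrite E set21.
have: f \in edge a b by rewrite E set22.
rewrite !inE => /orP [] /eqP fE /orP [] /eqP dE /orP [] /eqP bE /orP [] /eqP aE;
  subst; auto.
Qed.

(** * Adapted colorings and alternating paths inside a vertex set *)

Definition adapted_on (T : finType) (e : rel T) (c : {set T} -> color)
    (H : {set T}) (sigma : T -> color) : Prop :=
  forall u v : T, u \in H -> v \in H -> e u v ->
    sigma u <> c (edge u v) \/ sigma v <> c (edge u v).

Definition alternating_path_in (T : finType) (e : rel T)
    (c : {set T} -> color) (H : {set T}) (v : nat -> T) (s : nat) : Prop :=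
  [/\ {in [pred t | 1 <= t <= s] &, injective v},
      forall t, 1 <= t <= s -> v t \in H,
      forall t, 1 <= t < s -> e (v t) (v t.+1)
    & alternating_path c v s].

Definition rev_path (T : Type) (s : nat) (v : nat -> T) (t : nat) : T :=
  v (s.+1 - t).

(** For [k < s] the new first vertex is [v k.+1]. As [t + k <= s + s], one subtraction of [s]
    suffices to wrap around. *)
Definition rot_path (T : Type) (s k : nat) (v : nat -> T) (t : nat) : T :=
  if t + k <= s then v (t + k) else v (t + k - s).

Definition cons_path (T : Type) (w : T) (v : nat -> T) (t : nat) : T :=
  if t == 1 then w else v t.-1.

(** * Operations on alternating paths, and bicycles from their ends *)

Section AlternatingPaths.

Variables (T : finType) (e : rel T) (c : {set T} -> color).
Hypotheses (e_sym : symmetric e) (e_irr : irreflexive e).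

Implicit Types (H : {set T}) (v : nat -> T) (w : T) (s i j k : nat).

Lemma alternating_path_size H v s :
  alternating_path_in e c H v s -> s <= #|T|.
Proof.
case=> inj _ _ _.
have/card_uniqP : uniq (mkseq (fun t => v t.+1) s).
  apply/mkseq_uniqP => a b; rewrite !inE => a_lt b_lt /inj.
  by rewrite !inE => /(_ a_lt b_lt) [].
by rewrite size_mkseq => <-; exact: max_card.
Qed.

Lemma rev_alternating_path H v s :
  alternating_path_in e c H v s ->
  alternating_path_in e c H (rev_path s v) s.
Proof.
case=> inj vH ve va; split.
- move=> a b; rewrite !inE /rev_path => ab bb /inj.
  by rewrite !inE => /(_ ltac:(lia) ltac:(lia)); lia.
- by move=> t t_s; apply: vH; lia.
- move=> t t_s; rewrite /rev_path e_sym.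
  by rewrite (_ : s.+1 - t = (s.+1 - t.+1).+1); [apply: ve|]; lia.
- move=> t t_s; rewrite /rev_path.
  have /va : 2 <= s.+1 - t <= s.-1 by lia.
  rewrite (_ : s.+1 - t.-1 = (s.+1 - t).+1); last by lia.
  rewrite (_ : s.+1 - t.+1 = (s.+1 - t).-1); last by lia.
  by rewrite ![edge _ (v (s.+1 - t))]edgeC [edge (v (s.+1 - t)) _]edgeC => N /esym.
Qed.

(** For [0 < k] the closing edge becomes an inner edge, and the two color hypotheses give
    alternation at its ends. *)
Lemma rot_alternating_path H v s k : k < s ->
    alternating_path_in e c H v s -> e (v s) (v 1) ->
    c (edge (v s) (v 1)) <> c (edge (v 1) (v 2)) ->
    c (edge (v s.-1) (v s)) <> c (edge (v s) (v 1)) ->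
  alternating_path_in e c H (rot_path s k v) s.
Proof.
move=> k_s [inj vH ve va] es1 c1 cs; split.
- move=> a b; rewrite !inE /rot_path => ab bb.
  by case: ifP => ha; case: ifP => hb /inj;
    rewrite !inE => /(_ ltac:(lia) ltac:(lia)); lia.
- by move=> t t_s; rewrite /rot_path; case: ifP => tk; apply: vH; lia.
- move=> t t_s; rewrite /rot_path.
  case: (ltngtP (t + k) s) => tk.
  + by rewrite addSn; apply: ve; lia.
  + by rewrite addSn subSn; [apply: ve|]; lia.
  + by rewrite addSn tk subSnn.
- move=> t t_s; rewrite /rot_path.
  case: (ltngtP (t + k) s) => tk.
  + rewrite ifT; last by lia.
    rewrite addSn (_ : t.-1 + k = (t + k).-1); last by lia.
    by apply: va; lia.
  (* At [t + k = s.+1] the middle vertex is [v 1], entered by the closing edge. *)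
  + case: (eqVneq (t + k) s.+1) => tk1.
      rewrite ifT; last by lia.
      rewrite (_ : t.-1 + k = s); last by lia.
      rewrite (_ : t + k - s = 1); last by lia.
      by rewrite (_ : t.+1 + k - s = 2) //; lia.
    rewrite ifF; last by lia.
    rewrite (_ : t.-1 + k - s = (t + k - s).-1); last by lia.
    rewrite (_ : t.+1 + k - s = (t + k - s).+1); last by lia.
    by apply: va; lia.
  + rewrite ifT; last by lia.
    rewrite (_ : t.-1 + k = s.-1); last by lia.
    by rewrite (_ : t.+1 + k - s = 1) ?tk //; lia.
Qed.

Lemma cons_alternating_path H v s w :
    alternating_path_in e c H v s -> w \in H -> e w (v 1) ->
    c (edge w (v 1)) <> c (edge (v 1) (v 2)) ->
    (forall t, 1 <= t <= s -> w <> v t) ->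
  alternating_path_in e c H (cons_path w v) s.+1.
Proof.
move=> [inj vH ve va] wH ew cw w_new; split.
- move=> a b; rewrite !inE /cons_path => ab bb.
  case: eqP => a1; case: eqP => b1 //.
  + by rewrite a1 b1.
  + by move/w_new; lia.
  + by move/esym/w_new; lia.
  + by move/inj; rewrite !inE => /(_ ltac:(lia) ltac:(lia)); lia.
- by move=> t t_s; rewrite /cons_path; case: eqP => [//|t1]; apply: vH; lia.
- case=> [//|[|t]] t_s; rewrite /cons_path //=.
  by apply: ve; lia.
- case=> [//|[//|[|t]]] t_s; rewrite /cons_path //=.
  by apply: (va t.+2); lia.
Qed.

(** The color conditions keep the end edges off the path, where they could only be its first or last
    edge. The end edges coincide only when both join [v 1] to [v s], which is the excluded case. *)
Lemma alternating_bicycle_of_ends H v s i j :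
    alternating_path_in e c H v s -> 1 <= i <= s -> 1 <= j <= s ->
    e (v 1) (v i) -> c (edge (v 1) (v i)) <> c (edge (v 1) (v 2)) ->
    e (v s) (v j) -> c (edge (v s) (v j)) <> c (edge (v s.-1) (v s)) ->
    ~ (i = s /\ j = 1) ->
  exists F : {set {set T}}, F \subset edges e /\ alternating_bicycle c F.
Proof.
move=> [inj vH ve va] i_s j_s ei ci ej cj ij.
have s_gt1 : 1 < s.
  case: (ltnP 1 s) => // s1; have i1 : i = 1 by lia.
  by rewrite i1 e_irr in ei.
have vinj a b : 1 <= a <= s -> 1 <= b <= s -> v a = v b -> a = b.
  by move=> ab bb; apply: inj; rewrite inE.
have edgeE x y : e x y -> edge x y \in edges e.
  by move=> exy; apply: imset2_f.
exists (path_edges v s :|: [set edge (v 1) (v i); edge (v s) (v j)]); split.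
  apply/subsetP => f; rewrite !inE => /orP [/imsetP [t t0 ->]|].
    by apply: edgeE; apply: ve; rewrite inE in t0; have := ltn_ord t; lia.
  by case/orP => /eqP ->; exact: edgeE.
exists v, s, i, j; split=> //; split; split=> //.
- apply/imsetP => -[t t0 /edge_inj]; rewrite inE in t0; have t_s := ltn_ord t.
  case=> -[/vinj h1 /vinj h2].
    have t1 : 1 = t :> nat by apply: h1; lia.
    have i2 : i = t.+1 by apply: h2; lia.
    by case: ci; rewrite i2 -t1.
  by have := h1; lia.
- apply/imsetP => -[t t0 /edge_inj]; rewrite inE in t0; have t_s := ltn_ord t.
  case=> -[/vinj h1 /vinj h2].
    by have := h1; lia.
  have ts : s = t.+1 by apply: h1; lia.
  have jt : j = t by apply: h2; lia.
  by case: cj; rewrite jt edgeC (_ : s.-1 = t) //; lia.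
- apply/eqP => /edge_inj [] [/vinj h1 /vinj h2].
    by have := h1; lia.
  by case: ij; split; [apply: h2|apply/esym/h1]; lia.
Qed.

End AlternatingPaths.

Section NoBicycle.

Variables (T : finType) (e : rel T) (c : {set T} -> color).
Hypotheses (e_sym : symmetric e) (e_irr : irreflexive e).
Hypothesis no_bicycle :
  ~ exists F : {set {set T}}, F \subset edges e /\ alternating_bicycle c F.

(** * Longest alternating paths where every vertex sees both colors *)

Section LongestPath.

Variables (H : {set T}) (s : nat).
Hypothesis both_colors : forall x (a : color), x \in H ->
  exists w, [/\ w \in H, e x w & c (edge x w) <> a].
Hypothesis s_gt0 : 0 < s.
Hypothesis s_max : forall v, ~ alternating_path_in e c H v s.+1.

(** A neighbor off the path would extend it; [v 1] would be a loop and [v 2] has the wrong color.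
    For [s = 1] the value [v 2] is arbitrary, and no such [w] exists. *)
Lemma neighbor_on_path v w :
    alternating_path_in e c H v s -> w \in H -> e (v 1) w ->
    c (edge (v 1) w) <> c (edge (v 1) (v 2)) ->
  exists2 i, 2 < i <= s & w = v i.
Proof.
move=> vP wH ew cw.
have [[i i_s wi]|w_new] := classic (exists2 i, 1 <= i <= s & w = v i).
  exists i => //; case: i i_s wi => [//|[|[|i]]] i_s wi //.
    by rewrite wi e_irr in ew.
  by case: cw; rewrite wi.
case: (s_max (v := cons_path w v)); apply: cons_alternating_path => //.
- by rewrite e_sym.
- by rewrite edgeC.
- by move=> t t_s wt; case: w_new; exists t.
Qed.

(** Were [w] an earlier vertex, an off-color edge at the last vertex would complete a bicycle. *)
Lemma neighbor_eq_last v w :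
    alternating_path_in e c H v s -> w \in H -> e (v 1) w ->
    c (edge (v 1) w) <> c (edge (v 1) (v 2)) ->
  2 < s /\ w = v s.
Proof.
move=> vP wH ew cw.
have [i i_s wi] := neighbor_on_path vP wH ew cw.
case: (eqVneq i s) => [<-|i_ne]; first by split => //; case/andP: i_s.
have vsH : v s \in H by case: vP => _ vH _ _; apply: vH; lia.
have [w' [w'H ew' cw']] := both_colors (c (edge (v s.-1) (v s))) vsH.
have [||j j_s w'j] := neighbor_on_path (w := w') (rev_alternating_path e_sym vP) w'H.
- by rewrite /rev_path subSS subn0.
- by rewrite /rev_path subSS subn0 subSS subn1 [edge _ (v s.-1)]edgeC.
case: no_bicycle.
(* [j] is a position on the reversed path, hence [s.+1 - j] on [v]. *)
apply: (alternating_bicycle_of_ends e_irr vP (i := i) (j := s.+1 - j)); try lia.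
- by rewrite -wi.
- by rewrite -wi.
- by rewrite -/(rev_path s v j) -w'j.
- by rewrite -/(rev_path s v j) -w'j.
Qed.

Lemma alternating_cycle_closes v :
    alternating_path_in e c H v s ->
  [/\ 2 < s, e (v s) (v 1),
      c (edge (v s) (v 1)) <> c (edge (v 1) (v 2))
    & c (edge (v s.-1) (v s)) <> c (edge (v s) (v 1))].
Proof.
move=> vP; have vH : forall t, 1 <= t <= s -> v t \in H by case: vP.
have [w [wH ew cw]] := both_colors (c (edge (v 1) (v 2))) (vH 1 s_gt0).
have [s_gt2 ws] := neighbor_eq_last vP wH ew cw.
rewrite ws in ew cw.
have vsH : v s \in H by apply: vH; lia.
have [w' [w'H ew' cw']] := both_colors (c (edge (v s.-1) (v s))) vsH.
have [||_ w's] := neighbor_eq_last (rev_alternating_path e_sym vP) (w := w') w'H.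
- by rewrite /rev_path subSS subn0.
- by rewrite /rev_path subSS subn0 subSS subn1 [edge _ (v s.-1)]edgeC.
rewrite /rev_path subSnn in w's.
rewrite w's in cw'.
split=> //.
- by rewrite e_sym.
- by rewrite edgeC.
- by move/esym.
Qed.

(** Each color at [v 1] allows a single neighbor: [neighbor_eq_last] settles one color on [v] and
    the other on the cycle traversed backwards from [v 1]. *)
Lemma cycle_neighbors v w :
    alternating_path_in e c H v s -> w \in H -> e (v 1) w ->
  w = v 2 \/ (w = v s /\ c (edge (v 1) w) <> c (edge (v 1) (v 2))).
Proof.
move=> vP wH ew.
have [s_gt2 es1 c1 cs] := alternating_cycle_closes vP.
have [cw|cw] := classic (c (edge (v 1) w) = c (edge (v 1) (v 2))); last first.
  by right; split=> //; case: (neighbor_eq_last vP wH ew cw).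
left.
(* The rotation is [v 2, ..., v s, v 1]; its reversal [v 1, v s, ..., v 2] ends in [v 2]. *)
have rP : alternating_path_in e c H (rot_path s 1 v) s.
  by apply: rot_alternating_path => //; lia.
have r1 : rev_path s (rot_path s 1 v) 1 = v 1.
  by rewrite /rev_path /rot_path subSS subn0 addn1 ltnn subSnn.
have r2 : rev_path s (rot_path s 1 v) 2 = v s.
  by rewrite /rev_path /rot_path ifT; [congr v|]; lia.
have rs : rev_path s (rot_path s 1 v) s = v 2.
  by rewrite /rev_path /rot_path ifT; [congr v|]; lia.
have [||_ ->] := neighbor_eq_last (rev_alternating_path e_sym rP) (w := w) wH.
- by rewrite r1.
- by rewrite r1 r2 cw [edge (v 1) (v s)]edgeC => /esym.
- exact: rs.
Qed.

(** Rotation brings any cycle vertex to the front, where [cycle_neighbors] applies. An edge to the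
    successor [y] is avoided by [sigma y], an edge to the predecessor by [sigma x]. *)
Lemma cycle_component v :
    alternating_path_in e c H v s ->
  exists (C : {set T}) (sigma : T -> color),
    [/\ v 1 \in C, C \subset H
      & forall x y, x \in C -> y \in H -> e x y ->
          y \in C /\
          (sigma x <> c (edge x y) \/ sigma y <> c (edge x y))].
Proof.
move=> vP; have [s_gt2 es1 c1 cs] := alternating_cycle_closes vP.
have [inj vH _ _] := vP.
(* Positions in [p] start at 0, so a vertex of index [k] is the first vertex of [rot_path s k v]. *)
pose p := mkseq (fun t => v t.+1) s.
have p_uniq : uniq p.
  apply/mkseq_uniqP => a b; rewrite !inE => a_lt b_lt /inj.
  by rewrite !inE => /(_ a_lt b_lt) [].
have idx t : t < s -> index (v t.+1) p = t.
  move=> t_s; have /= <- := nth_mkseq (v 0) (fun t => v t.+1) t_s.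
  by rewrite index_uniq // size_mkseq.
have in_p t : t < s -> v t.+1 \in p.
  by move=> t_s; rewrite -index_mem idx // size_mkseq.
have p_in x : x \in p -> exists2 t, t < s & x = v t.+1.
  by case/mapP => t; rewrite mem_iota => t_s ->; exists t.
pose r k := rot_path s k v.
pose sigma x := c (edge (r (index x p) 1) (r (index x p) 2)).
exists [set x in p], sigma; split.
- by rewrite inE; apply: in_p.
- apply/subsetP => x; rewrite inE => /p_in [t t_s ->].
  by apply: vH; lia.
move=> x y; rewrite inE => /p_in [k k_s ->] yH exy.
have rP : alternating_path_in e c H (r k) s.
  exact: rot_alternating_path.
have r1 : r k 1 = v k.+1 by rewrite /r /rot_path add1n k_s.
rewrite -r1 in exy.
have in_r t : 1 <= t <= s -> r k t \in p.
  move=> t_s; rewrite /r /rot_path; case: ifP => tk.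
    by rewrite (_ : t + k = (t + k).-1.+1); [apply: in_p|]; lia.
  by rewrite (_ : t + k - s = (t + k - s).-1.+1); [apply: in_p|]; lia.
have [y2|[ys cy]] := cycle_neighbors rP yH exy.
  split; first by rewrite inE y2; apply: in_r; lia.
  right; rewrite /sigma.
  (* The edge following [y] is the second edge of [r k]; the case [k.+1 = s], where [y] is [v 1],
     wraps around. *)
  have -> : c (edge (r (index y p) 1) (r (index y p) 2))
             = c (edge (r k 2) (r k 3)).
    rewrite y2 /r /rot_path; case: (ltnP k.+1 s) => k1.
      by rewrite [2 + k]add2n idx // add1n k1 (_ : 2 + k.+1 = 3 + k) //; lia.
    rewrite (_ : 2 + k - s = 1) ?idx ?addn0 ?s_gt0; [|lia..].
    rewrite ifT; last by lia.
    rewrite ifF; last by lia.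
    by rewrite (_ : 3 + k - s = 2) //; lia.
  by case: rP => _ _ _ /(_ 2) ra; rewrite -r1 y2 => /esym; apply: ra; lia.
split; first by rewrite inE ys; apply: in_r; lia.
by left; rewrite /sigma idx // -r1 => /esym.
Qed.

End LongestPath.

(** * Adapted colorings by induction on the vertex set *)

Lemma exists_longest_path (H : {set T}) x : x \in H ->
  exists (v : nat -> T) (s : nat),
    [/\ 0 < s, alternating_path_in e c H v s
      & forall v', ~ alternating_path_in e c H v' s.+1].
Proof.
move=> xH; apply: NNPP => no_longest.
have long n : exists v, alternating_path_in e c H v n.+1.
  elim: n => [|n [v vP]].
    exists (fun=> x); split=> //; last by case=> [|[]].
    - by move=> a b; rewrite !inE; lia.
    - by move=> t; lia.
  apply: NNPP => no_v; apply: no_longest; exists v, n.+1; split=> // v' v'P.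
  by apply: no_v; exists v'.
have [v /alternating_path_size] := long #|T|.
by rewrite ltnn.
Qed.

(** Strong induction on [#|H|] replaces the choice of a minimal [H]: either a cycle component splits
    off, or a vertex missing a color is removed. *)
Lemma exists_adapted_on (H : {set T}) : exists sigma, adapted_on e c H sigma.
Proof.
have [n] := ubnP #|H|; elim: n H => [//|n IHn] H H_n.
have [[x xH]|H0] := classic (exists x, x \in H); last first.
  by exists (fun=> Red) => u v uH; case: H0; exists u.
have [both|/not_all_ex_not [y /not_all_ex_not [a ya]]] :=
  classic (forall x (a : color), x \in H ->
             exists w, [/\ w \in H, e x w & c (edge x w) <> a]).
- have [v [s [s_gt0 vP s_max]]] := exists_longest_path xH.
  have [C [sigma [v1C CH Cs]]] := cycle_component both s_gt0 s_max vP.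
  have [|tau tauP] := IHn (H :\: C).
    have : #|H :&: C| > 0.
      by apply/card_gt0P; exists (v 1); rewrite inE v1C (subsetP CH).
    by have := cardsID C H; lia.
  (* No edge joins [C] to [H :\: C], so the two colorings can be glued. *)
  exists (fun x => if x \in C then sigma x else tau x) => y z yH zH eyz.
  case: (boolP (y \in C)) => yC.
    by case: (Cs y z yC zH eyz) => ->.
  case: (boolP (z \in C)) => zC.
    by rewrite e_sym in eyz; case: (Cs z y zC yH eyz); rewrite (negbTE yC).
  by apply: tauP => //; rewrite inE ?yC ?zC.
- have [yH no_w] := imply_to_and _ _ ya.
  have only_a w : w \in H -> e y w -> c (edge y w) = a.
    by move=> wH eyw; apply: NNPP => cw; apply: no_w; exists w.
  have [|tau tauP] := IHn (H :\ y); first by rewrite (cardsD1 y H) yH in H_n.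
  (* All edges from [y] into [H] have color [a], so the opposite color at [y] settles each of them,
     whatever the other end gets. *)
  pose a' := if a is Red then Blue else Red.
  have a'a : a' <> a by rewrite /a'; case: (a).
  exists (fun x => if x == y then a' else tau x) => u w uH wH euw.
  case: (eqVneq u y) => [uy|u_ne].
    by left; rewrite uy only_a // -uy.
  case: (eqVneq w y) => [wy|w_ne].
    by right; rewrite edgeC wy only_a // -wy e_sym.
  by apply: tauP; rewrite // !inE ?u_ne ?w_ne.
Qed.

End NoBicycle.

Theorem lemma2p2 (T : finType) (e : rel T) (e_sym : symmetric e)
    (e_irr : irreflexive e) (c : {set T} -> color)
    (e_conn : graph_connected e)
    (not_col : ~ adaptably_2_colorable e c) :
  exists F : {set {set T}}, F \subset edges e /\ alternating_bicycle c F.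
Proof.
apply: NNPP => no_bicycle; apply: not_col.
have [sigma sigmaP] := exists_adapted_on e_sym e_irr no_bicycle setT.
by exists sigma => u v; apply: sigmaP; rewrite inE.
Qed.
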